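(* Let $G=(V,E)$ be a graph with $V=\{1,\dots,n\}$, let $\Sigma\subseteq\mathrm{Aut}(G)$ and let $v\colon V\to\mathbb{R}^d$ be a full-dimensional irreducible $\Sigma$-realization of $G$. Suppose that $G$ has a unique eigenvalue $\theta$ of largest multiplicity $\mu_1$, and that the second largest multiplicity of any eigenvalue of $G$ is $\mu_2$. Then: (i) if $\mu_2<d$, then $v$ is balanced with eigenvalue $\theta$; (ii) if moreover $\mu_1<2d$, then $v$ is rigid.
   Context: $G$ is a finite simple undirected graph with adjacency matrix $A$; eigenvalues and multiplicities of $G$ are those of $A$; $N(i)$ is the neighbourhood of $i$. A realization $v\colon V\to\mathbb{R}^d$ is full-dimensional if the $v_i$ span $\mathbb{R}^d$; its arrangement space is the column span of the matrix $M\in\mathbb{R}^{n\times d}$ with rows $v_i^\top$. It is a $\Sigma$-realization if there is a group homomorphism $T\colon\Sigma\to\mathrm{O}(\mathbb{R}^d)$ with $T_\sigma v_i=v_{\sigma(i)}$ for all $i,\sigma$; irreducible if $T$ has no invariant subspaces other than $\{0\}$ and $\mathbb{R}^d$. It is balanced with eigenvalue $\theta$ if $\sum_{j\in N(i)}v_j=\theta v_i$ for all $i$. $\mathcal{R}_d(G,\Sigma)$ denotes the set of full-dimensional $d$-dimensional $\Sigma$-realizations, as a subset of $\mathbb{R}^{n\times d}$ with the subspace topology; two realizations are equivalent if they have the same arrangement space; $v$ is rigid if there is no continuous curve $\gamma\colon[0,1]\to\mathcal{R}_d(G,\Sigma)$ with $\gamma(0)=v$ and $\gamma(1)$ not equivalent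 to $v$. *)

(* Defs.v *)
From HB Require Import structures.
From mathcomp Require Import all_boot all_order all_algebra all_fingroup.
From mathcomp Require Import mxrepresentation.
From mathcomp Require Import all_classical all_reals all_analysis.

Set Implicit Arguments.
Unset Strict Implicit.
Unset Printing Implicit Defensive.

Import Order.TTheory GRing.Theory Num.Theory.
Import numFieldNormedType.Exports.

Local Open Scope classical_set_scope.
Local Open Scope ring_scope.

Record sgraph (n : nat) := SGraph {
  adj :> rel 'I_n;
  adj_sym : symmetric adj;
  adj_irr : irreflexive adj }.

Definition graph_aut (n : nat) (G : sgraph n) : {set {perm 'I_n}} :=
  [set s : {perm 'I_n} | [forall i, forall j, G (s i) (s j) == G i j]]%SET.

Definition adjmx (R : realType) (n : nat) (G : sgraph n) : 'M[R]_n :=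
  \matrix_(i, j) (G i j)%:R.

Definition geigenvalue (R : realType) (n : nat) (G : sgraph n) (t : R) : Prop :=
  eigenvalue (adjmx R G) t.

(* The adjacency matrix is real symmetric, so its left and right eigenspaces
   coincide and geometric and algebraic multiplicities agree. *)
Definition gmult (R : realType) (n : nat) (G : sgraph n) (t : R) : nat :=
  \rank (eigenspace (adjmx R G) t).

Definition unique_largest_mult (R : realType) (n : nat) (G : sgraph n)
    (t : R) (mu1 : nat) : Prop :=
  [/\ geigenvalue G t, gmult G t = mu1
    & forall s : R, geigenvalue G s -> s != t -> (gmult G s < mu1)%N].

(* To be used when [t] is the unique eigenvalue of largest multiplicity.  If
   [t] is the only eigenvalue (the edgeless graph), the second largest
   multiplicity is 0 by convention. *)
Definition second_largest_mult (R : realType) (n : nat) (G : sgraph n)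
    (t : R) (mu2 : nat) : Prop :=
  (exists s : R, [/\ geigenvalue G s, s != t, gmult G s = mu2
     & forall r : R, geigenvalue G r -> r != t -> (gmult G r <= mu2)%N])
  \/ ((forall s : R, geigenvalue G s -> s = t) /\ mu2 = 0%N).

(* A realization v : V -> R^d is identified with the n x d matrix whose i-th
   row is v_i. *)
Definition full_dimensional (R : realType) (n d : nat) (v : 'M[R]_(n, d)) :
  Prop := row_full v.

(* Column spans, as row spaces of the transposes. *)
Definition realization_equiv (R : realType) (n d : nat) (v w : 'M[R]_(n, d)) :
  Prop := (v^T == w^T)%MS.

(* Linear maps act on row vectors from the right: T_s is x |-> x *m T s.  This
   matches the product of permutations, (s * t) i = t (s i), so a homomorphism
   from Sigma is exactly an mx_representation. *)
Definition symmetry_repr (R : realType) (n d : nat)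
    (Sigma : {group {perm 'I_n}}) (v : 'M[R]_(n, d))
    (T : mx_representation R Sigma d) : Prop :=
  (forall s, s \in Sigma -> T s *m (T s)^T = 1%:M) /\
  (forall s, s \in Sigma -> forall i, row i v *m T s = row (s i) v).

Definition sym_realization (R : realType) (n d : nat)
    (Sigma : {group {perm 'I_n}}) (v : 'M[R]_(n, d)) : Prop :=
  exists T : mx_representation R Sigma d, symmetry_repr v T.

Definition irreducible_sym_realization (R : realType) (n d : nat)
    (Sigma : {group {perm 'I_n}}) (v : 'M[R]_(n, d)) : Prop :=
  exists T : mx_representation R Sigma d,
    symmetry_repr v T /\
    forall U : 'M[R]_d, mxmodule T U -> U = 0 \/ row_full U.

Definition balanced (R : realType) (n d : nat) (G : sgraph n)
    (v : 'M[R]_(n, d)) (t : R) : Prop :=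
  forall i : 'I_n, \sum_(j | G i j) row j v = t *: row i v.

(* R_d(G, Sigma); the graph enters only through Sigma \subset graph_aut G. *)
Definition realization_space (R : realType) (n d : nat)
    (Sigma : {group {perm 'I_n}}) : set 'M[R]_(n, d) :=
  [set v : 'M[R]_(n, d) | full_dimensional v /\ sym_realization Sigma v].

Definition rigid (R : realType) (n d : nat)
    (Sigma : {group {perm 'I_n}}) (v : 'M[R]_(n, d)) : Prop :=
  ~ exists gamma : R -> 'M[R]_(n, d),
      [/\ {within `[0, 1], continuous gamma},
          forall t : R, 0 <= t <= 1 -> realization_space Sigma (gamma t),
          gamma 0 = v
        & ~ realization_equiv (gamma 1) v].

(* Main.v *)
(** Let [A] be the adjacency matrix.  The transpose [u] of a symmetric
realization is an equivariant map from its representation to the permutation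
representation, and [A] commutes with the latter.  As [A] is symmetric, the
product of the [A - r], for finitely many distinct reals [r], vanishes.  If the
representation is irreducible, an equivariant map killed by [A - r] is zero or
injective with image in the [r]-eigenspace, and the latter is too small for
that when [r <> theta]; so these factors can be cancelled and
[u (A - theta) = 0].

For rigidity, [v^T w] intertwines the representations of two realizations [v]
and [w].  Along a curve it is invertible for nearby parameters, because the
Gram matrix of a full-dimensional realization is invertible.  Irreducibility is
therefore locally constant on the curve, and the endpoint is balanced with the
same eigenvalue.  Two irreducible arrangement spaces of dimension [d] in an
eigenspace of dimension less than [2 d] meet, hence coincide. *)

Require Import Defs.
From HB Require Import structures.
From mathcomp Require Import all_boot all_order all_algebra all_fingroup.
From mathcomp Require Import mxrepresentation spectral.
From mathcomp Require Import all_classical all_reals all_analysis.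
From mathcomp Require Import complex.

Set Implicit Arguments.
Unset Strict Implicit.
Unset Printing Implicit Defensive.

Import Order.TTheory GRing.Theory Num.Theory.
Import numFieldNormedType.Exports.

Local Open Scope ring_scope.

(** * Annihilating products of symmetric real matrices *)

Lemma eigenvector_mul_prod (F : fieldType) (n : nat) (A : 'M[F]_n) (rs : seq F)
    (x : 'rV[F]_n) (a : F) :
  x *m A = a *: x ->
  x *m (\prod_(r <- rs) (A - r%:M)) = (\prod_(r <- rs) (a - r)) *: x.
Proof.
move=> xA; elim: rs => [|r rs IH]; first by rewrite !big_nil mulmx1 scale1r.
rewrite !big_cons mulmxA mulmxBr xA mul_mx_scalar -scalerBl -scalemxAl IH.
by rewrite scalerA.
Qed.

(** Over [R[i]] the matrix is Hermitian, hence unitarily diagonalizable with real spectrum; the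
    distinct eigenvalues serve as [rs]. *)
Lemma symmetric_prod_eq0 (R : rcfType) (n : nat) (A : 'M[R]_n) :
  A^T = A ->
  exists2 rs : seq R, uniq rs & \prod_(r <- rs) (A - r%:M) = 0.
Proof.
move=> symA; pose f := real_complex R; pose B : 'M[R[i]]_n := map_mx f A.
have Bherm : B \is hermsymmx.
  apply: realsym_hermsym.
    apply/sesquilinear.is_hermitianmxP; rewrite expr0 scale1r map_mx_id //.
    by rewrite /B map_trmx symA.
  by apply/mxOverP => i j; rewrite mxE; apply/complex_realP; exists (A i j).
pose P := spectralmx B; pose D := spectral_diag B.
have PB : P *m B = diag_mx D *m P.
  have /orthomx_spectralP -> := hermitian_normalmx Bherm.
  by rewrite !mulmxA mulmxV ?spectral_unit // mul1mx.
have /mxOverP Dreal := hermitian_spectral_diag_real Bherm.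
pose rs := undup [seq complex.Re (D 0 i) | i : 'I_n].
exists rs; first exact: undup_uniq.
apply: (map_mx_inj (f := f)); rewrite map_mx0.
have -> : map_mx f (\prod_(r <- rs) (A - r%:M)) =
    \prod_(r <- map f rs) (B - r%:M).
  elim: rs => [|r rs IH]; first by rewrite !big_nil map_mx1.
  by rewrite !big_cons map_mxM IH map_mxB map_scalar_mx.
(* [P] is invertible and its rows are left eigenvectors of [B], so it is enough that the product
   kills each row. *)
suff : P *m \prod_(r <- map f rs) (B - r%:M) = 0.
  by move=> /(congr1 (mulmx (invmx P))); rewrite mulKmx ?spectral_unit // mulmx0.
apply/row_matrixP => i; rewrite row_mul row0 (eigenvector_mul_prod _ (a := D 0 i)).
  have /complex_realP[k Dk] := Dreal 0 i.
  suff -> : \prod_(r <- map f rs) (D 0 i - r) = 0 by rewrite scale0r.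
  apply/eqP; rewrite prodf_seq_eq0; apply/hasP; exists (D 0 i).
    rewrite Dk; apply: map_f; rewrite mem_undup; apply/mapP.
    by exists i; rewrite ?mem_enum // Dk.
  by rewrite subrr eqxx.
rewrite -row_mul PB; apply/rowP => j.
by rewrite mul_diag_mx !mxE.
Qed.

Lemma mulmx_tr_eq0 (R : realFieldType) (m n : nat) (y : 'M[R]_(m, n)) :
  y *m y^T = 0 -> y = 0.
Proof.
move=> yy0; apply/matrixP => i j; rewrite mxE.
have /eqP := congr1 (fun M : 'M[R]_m => M i i) yy0; rewrite !mxE psumr_eq0.
  by move=> /allP/(_ j (mem_index_enum _)); rewrite /= mxE mulf_eq0 orbb => /eqP.
by move=> k _; rewrite mxE -expr2 sqr_ge0.
Qed.

(** If [x *m u *m u^T = 0] then [y := x *m u] satisfies [y *m y^T = 0], so [y = 0] by positivity. *)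
Lemma row_free_mulmx_tr (R : realFieldType) (m n : nat) (u : 'M[R]_(m, n)) :
  row_free u -> u *m u^T \in unitmx.
Proof.
move=> ufree; rewrite -row_free_unit -kermx_eq0; apply/eqP.
apply: (row_free_inj ufree); rewrite mul0mx; apply: mulmx_tr_eq0.
by rewrite trmx_mul mulmxA -(mulmxA (kermx _)) mulmx_ker mul0mx.
Qed.

(** * Equivariant maps into the permutation representation *)

Definition irreducible_repr (F : fieldType) (gT : finGroupType) (G : {group gT})
    (d : nat) (T : mx_representation F G d) : Prop :=
  forall U : 'M[F]_d, mxmodule T U -> U = 0 \/ row_full U.

(* The rows of [u] span an image of the representation [T] inside the
   permutation representation on row vectors; for a symmetric realization [v],
   this holds with [u := v^T]. *)
Definition perm_hom (F : fieldType) (n d : nat) (Sigma : {group {perm 'I_n}})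
    (T : mx_representation F Sigma d) (u : 'M[F]_(d, n)) : Prop :=
  forall s, s \in Sigma -> T s *m u = u *m perm_mx s.

Section PermHom.

Variables (F : fieldType) (n d : nat) (Sigma : {group {perm 'I_n}}).
Implicit Types (T : mx_representation F Sigma d) (u : 'M[F]_(d, n)).

(** The kernel of [u] is a submodule of [T]. *)
Lemma perm_hom_schur T u :
  irreducible_repr T -> perm_hom T u -> u = 0 \/ row_free u.
Proof.
move=> irrT homu; have [|ker0|] := irrT (kermx u).
- apply/mxmoduleP => s sS; apply/sub_kermxP.
  by rewrite -mulmxA homu // mulmxA mulmx_ker mul0mx.
- by right; rewrite -kermx_eq0 ker0.
- rewrite row_full_unit => Kunit; left.
  by rewrite -[u](mulKmx Kunit) mulmx_ker mulmx0.
Qed.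

Lemma perm_hom_mulmx T u (B : 'M[F]_n) :
  (forall s, s \in Sigma -> perm_mx s *m B = B *m perm_mx s) ->
  perm_hom T u -> perm_hom T (u *m B).
Proof. by move=> comB homu s sS; rewrite mulmxA homu // -!mulmxA comB. Qed.

(** The vectors that [u] sends into the row space of [w] form a submodule of [T], nonzero as soon as
    the two images meet. *)
Lemma perm_hom_sub T T' u w :
  irreducible_repr T -> perm_hom T u -> perm_hom T' w ->
  (u :&: w)%MS != 0 -> (u <= w)%MS.
Proof.
move=> irrT homu homw capN0.
have memK m (x : 'M[F]_(m, d)) :
    (x <= kermx (u *m cokermx w))%MS = (x *m u <= w)%MS.
  by rewrite (submxE (x *m u)) -mulmxA; apply/sub_kermxP/eqP.
have [|K0|] := irrT (kermx (u *m cokermx w)).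
- apply/mxmoduleP => s sS; rewrite memK -mulmxA homu // mulmxA.
  have /submxP[y ->] : (kermx (u *m cokermx w) *m u <= w)%MS by rewrite -memK.
  by rewrite -mulmxA -homw // mulmxA submxMl.
- case/eqP: capN0; have /submxP[x xE] := capmxSl u w.
  have := capmxSr u w; rewrite xE -memK K0 submx0 => /eqP ->.
  by rewrite mul0mx.
- by rewrite -sub1mx memK mul1mx.
Qed.

Section Spectrum.

Variables (A : 'M[F]_n) (theta : F) (T : mx_representation F Sigma d).
Hypothesis comA : forall s, s \in Sigma -> perm_mx s *m A = A *m perm_mx s.
Hypothesis irrT : irreducible_repr T.
Hypothesis small_eigenspace :
  forall r, r != theta -> (\rank (eigenspace A r) < d)%N.

Lemma perm_hom_subr_scalar u r : perm_hom T u -> perm_hom T (u *m (A - r%:M)).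
Proof.
by apply: perm_hom_mulmx => s sS; rewrite mulmxBl mulmxBr comA // scalar_mxC.
Qed.

Lemma perm_hom_subr_scalar_eq0 u r :
  r != theta -> perm_hom T u -> u *m (A - r%:M) = 0 -> u = 0.
Proof.
move=> r_neq homu /eqP; rewrite mulmxBr mul_mx_scalar subr_eq0 => /eqP uA.
have [//|/eqP ufree] := perm_hom_schur irrT homu.
have /mxrankS : (u <= eigenspace A r)%MS by apply/eigenspaceP.
by rewrite ufree leqNgt small_eigenspace.
Qed.

Lemma perm_hom_prod_eq0 (rs : seq F) u :
  theta \notin rs -> perm_hom T u ->
  u *m (\prod_(r <- rs) (A - r%:M)) = 0 -> u = 0.
Proof.
elim: rs u => [|r rs IH] u; first by rewrite big_nil mulmx1.
rewrite inE negb_or eq_sym big_cons mulmxA => /andP[r_neq rsN] homu u0.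
apply: (perm_hom_subr_scalar_eq0 r_neq homu).
exact: IH _ rsN (perm_hom_subr_scalar r homu) u0.
Qed.

(** Induction on [rs]: a factor with [r != theta] is cancelled, and once [theta] is met, uniqueness
    keeps it out of the remaining factors, which all cancel. *)
Lemma perm_hom_eigen_of_prod (rs : seq F) u :
  uniq rs -> perm_hom T u ->
  u *m (\prod_(r <- rs) (A - r%:M)) = 0 -> u *m (A - theta%:M) = 0.
Proof.
elim: rs u => [|r rs IH] u.
  by rewrite big_nil mulmx1 => _ _ ->; rewrite mul0mx.
rewrite cons_uniq big_cons mulmxA => /andP[rN rs_uniq] homu u0.
have homu' a := perm_hom_subr_scalar a homu.
have [r_eq | r_neq] := eqVneq r theta.
  by apply: (perm_hom_prod_eq0 (rs := rs)); rewrite -?r_eq.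
apply: (perm_hom_subr_scalar_eq0 r_neq) => //.
rewrite -mulmxA.
(* Swapping the factors lets the induction hypothesis apply to [u *m (A - r%:M)]. *)
suff -> : (A - theta%:M) *m (A - r%:M) = (A - r%:M) *m (A - theta%:M).
  by rewrite mulmxA; apply: IH.
apply: comm_mxB (comm_mx_scalar _ _); apply: comm_mx_sym.
exact: comm_mxB (comm_mx_refl _) (comm_mx_scalar _ _).
Qed.

End Spectrum.

End PermHom.

Lemma symmetry_repr_perm (R : realType) (n d : nat) (Sigma : {group {perm 'I_n}})
    (v : 'M[R]_(n, d)) (T : mx_representation R Sigma d) s :
  symmetry_repr v T -> s \in Sigma -> perm_mx s *m v = v *m T s.
Proof.
move=> [_ Tv] sS; apply/row_matrixP => i; rewrite -row_permE row_mul Tv //.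
by apply/rowP => j; rewrite !mxE.
Qed.

(** By orthogonality [T s] is the transpose of [T s^-1], so transposing the relation at [s^-1] gives
    the one at [s]. *)
Lemma symmetry_repr_hom (R : realType) (n d : nat) (Sigma : {group {perm 'I_n}})
    (v : 'M[R]_(n, d)) (T : mx_representation R Sigma d) :
  symmetry_repr v T -> perm_hom T v^T.
Proof.
move=> vT s sS; have [Torth _] := vT.
have sVS : (s^-1)%g \in Sigma by rewrite groupV.
have -> : T s = (T (s^-1)%g)^T.
  rewrite repr_mxV //; have /mulmx1_unit[Tunit _] := Torth s sS.
  have -> : invmx (T s) = (T s)^T.
    by rewrite -[RHS](mulKmx Tunit) Torth // mulmx1.
  by rewrite trmxK.
by rewrite -trmx_mul -(symmetry_repr_perm vT) // trmx_mul tr_perm_mx invgK.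
Qed.

(* [v^T *m w] intertwines the two representations. *)
Lemma irreducible_sym_realization_transfer (R : realType) (n d : nat)
    (Sigma : {group {perm 'I_n}}) (v w : 'M[R]_(n, d)) :
  irreducible_sym_realization Sigma v -> sym_realization Sigma w ->
  v^T *m w \in unitmx -> irreducible_sym_realization Sigma w.
Proof.
move=> [T [vT irrT]] [T' wT'] Cunit; exists T'; split=> // U modU.
have homv := symmetry_repr_hom vT.
have CT s : s \in Sigma -> T s *m (v^T *m w) = v^T *m w *m T' s.
  by move=> sS; rewrite mulmxA homv // -!mulmxA (symmetry_repr_perm wT').
move: (v^T *m w) Cunit CT => C Cunit CT.
(* The inverse intertwiner carries a submodule of [T'] to a submodule of [T] of the same rank. *)
have modUC : mxmodule T (U *m invmx C).
  apply/mxmoduleP => s sS.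
  have -> : U *m invmx C *m T s = U *m T' s *m invmx C.
    apply: (can_inj (mulmxK Cunit)).
    by rewrite mulmxKV // -!mulmxA CT // mulKmx.
  by apply: submxMr; move/mxmoduleP: modU; apply.
have [UC0 | UCfull] := irrT _ modUC; [left | right].
  by rewrite -[U](mulmxKV Cunit) UC0 mul0mx.
by move: UCfull; rewrite !row_full_unit unitmx_mul unitmx_inv Cunit andbT.
Qed.

Local Open Scope classical_set_scope.

(** * Irreducibility along curves *)

Section Continuity.

Variables (R : realType) (T : topologicalType) (x : T).

Lemma cvg_det (d : nat) (M : T -> 'M[R]_d) :
  (forall i j, M t i j @[t --> x] --> M x i j) ->
  \det (M t) @[t --> x] --> \det (M x).
Proof.
move=> cM; apply: cvg_big => [|s _]; first exact: add_continuous.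
apply: cvgM; first exact: cvg_cst.
by apply: cvg_big => [|i _]; [exact: mul_continuous | exact: cM].
Qed.

Lemma cvg_mulmx_entry (m n p : nat) (u : 'M[R]_(m, n)) (M : T -> 'M[R]_(n, p)) i j :
  (forall i j, M t i j @[t --> x] --> M x i j) ->
  (u *m M t) i j @[t --> x] --> (u *m M x) i j.
Proof.
move=> cM; rewrite mxE; under eq_fun do rewrite mxE.
apply: cvg_big => [|k _]; first exact: add_continuous.
by apply: cvgM; [exact: cvg_cst | exact: cM].
Qed.

End Continuity.

(** The indicator of [P] is continuous on the segment; if it dropped from 1 to 0 it would take the
    value 1/2. *)
Lemma locally_constant_segment (R : realType) (P : R -> Prop) :
  (forall x : R, 0 <= x <= 1 ->
     \forall t \near (x : subspace `[0%R, 1%R]), P t <-> P x) ->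
  P 0 -> P 1.
Proof.
move=> Ploc P0; apply: contrapT => P1.
pose f (t : R) : R := `[< P t >]%:R.
have fc : {within `[0, 1], continuous f}.
  rewrite continuous_subspace_in => x /set_mem /=; rewrite in_itv /= => /Ploc Px.
  apply: (@cvg_trans _ (f x @[_ --> (x : subspace `[0%R, 1%R])]));
    last exact: cvg_cst.
  apply: near_eq_cvg; apply: filterS Px => t Pt.
  by rewrite /f /from_subspace /= (asbool_equiv_eq Pt).
have f0 : f 0 = 1 by rewrite /f asboolT.
have f1 : f 1 = 0 by rewrite /f asboolF.
have [] := IVT (v := 2^-1) ler01 fc.
  rewrite f0 f1 minC maxC (min_idPl ler01) (max_idPr ler01).
  by rewrite invr_ge0 ler0n invf_le1 ?ltr0n // ler1n.
move=> c _; rewrite /f; case: asboolP => _ /= /eqP.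
  by rewrite eq_sym invr_eq1 (eqr_nat _ 2 1).
by rewrite eq_sym invr_eq0 (eqr_nat _ 2 0).
Qed.

Lemma irreducible_sym_realization_curve (R : realType) (n d : nat)
    (Sigma : {group {perm 'I_n}}) (gamma : R -> 'M[R]_(n, d)) :
  {within `[0, 1], continuous gamma} ->
  (forall t : R, 0 <= t <= 1 -> realization_space Sigma (gamma t)) ->
  irreducible_sym_realization Sigma (gamma 0) ->
  irreducible_sym_realization Sigma (gamma 1).
Proof.
move=> gammac gammaS.
apply: (@locally_constant_segment _
  (fun t => irreducible_sym_realization _ (gamma t))).
move=> x x01; have [xfull xsym] := gammaS x x01.
have Gunit : (gamma x)^T *m gamma x \in unitmx.
  by rewrite -[X in _ *m X]trmxK row_free_mulmx_tr // /row_free mxrank_tr.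
have entryc i j : gamma t i j @[t --> (x : subspace `[0%R, 1%R])] --> gamma x i j.
  exact: (cvg_comp _ (fun M : 'M[R]_(n, d) => M i j) (gammac x)
    (@coord_continuous _ _ _ i j _)).
have detc : \det ((gamma x)^T *m gamma t)
    @[t --> (x : subspace `[0%R, 1%R])] --> \det ((gamma x)^T *m gamma x).
  by apply: cvg_det => i j; apply: cvg_mulmx_entry.
have in01 : \forall t \near (x : subspace `[0%R, 1%R]), 0 <= t <= 1.
  apply/nbhs_subspace_ex; first by rewrite /= in_itv.
  by exists setT; [exact: filterT | rewrite set_itvcc setIid setTI].
have : \forall t \near (x : subspace `[0%R, 1%R]),
    \det ((gamma x)^T *m gamma t) != 0.
  by apply: (cvgr_neq0 _ detc); rewrite -unitfE -unitmxE.
apply: filterS2 in01 => t /gammaS[_ tsym]; rewrite -unitfE -unitmxE => Cunit.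
split=> irr; apply: irreducible_sym_realization_transfer irr _ _ => //.
(* Back from [gamma t] to [gamma x], the intertwiner is the transpose of the previous one, hence
   also invertible. *)
by rewrite -unitmx_tr trmx_mul trmxK.
Qed.

(** * Balanced realizations of graphs *)

Lemma adjmx_perm_comm (R : realType) (n : nat) (G : sgraph n) (s : {perm 'I_n}) :
  s \in graph_aut G -> perm_mx s *m adjmx R G = adjmx R G *m perm_mx s.
Proof.
rewrite inE => /forallP/(_ _)/forallP Gs.
rewrite -row_permE -[s in RHS]invgK -col_permE; apply/matrixP => i j.
by rewrite !mxE -(eqP (Gs i _)) permKV.
Qed.

Lemma adjmx_tr (R : realType) (n : nat) (G : sgraph n) :
  (adjmx R G)^T = adjmx R G.
Proof. by apply/matrixP => i j; rewrite !mxE adj_sym. Qed.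

Lemma balancedP (R : realType) (n d : nat) (G : sgraph n) (v : 'M[R]_(n, d)) t :
  balanced G v t <-> v^T *m adjmx R G = t *: v^T.
Proof.
have rowA i : row i (adjmx R G *m v) = \sum_(j | G i j) row j v.
  rewrite row_mul mulmx_sum_row [RHS]big_mkcond; apply: eq_bigr => j _.
  by rewrite !mxE; case: (G i j); rewrite ?scale1r ?scale0r.
rewrite -[in X in _ <-> X]adjmx_tr -trmx_mul -linearZ /=.
split=> [bal | /trmx_inj Av i].
  by congr (_^T); apply/row_matrixP => i; rewrite rowA bal linearZ.
by rewrite -rowA Av linearZ.
Qed.

(** Reals that are not eigenvalues have a zero eigenspace; they are included because the elements of
    [rs] in [symmetric_prod_eq0] are not stated to be eigenvalues. *)
Lemma gmult_le_second (R : realType) (n : nat) (G : sgraph n) (t : R) (mu2 : nat) :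
  second_largest_mult G t mu2 -> forall r, r != t -> (gmult G r <= mu2)%N.
Proof.
move=> hmu2 r r_neq; have [r_eig | ] := boolP (eigenvalue (adjmx R G) r).
  case: hmu2 => [[s [_ _ _]] | [all_t _]]; first exact.
  by rewrite (all_t r r_eig) eqxx in r_neq.
by rewrite negbK => /eqP r0; rewrite /gmult r0 mxrank0.
Qed.

Lemma irreducible_balanced (R : realType) (n d : nat) (G : sgraph n)
    (Sigma : {group {perm 'I_n}}) (v : 'M[R]_(n, d)) (theta : R) :
  Sigma \subset graph_aut G -> irreducible_sym_realization Sigma v ->
  (forall r, r != theta -> (gmult G r < d)%N) -> balanced G v theta.
Proof.
move=> /fintype.subsetP SG [T [vT irrT]] small; apply/balancedP.
have comA s (sS : s \in Sigma) := adjmx_perm_comm R (SG s sS).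
have [rs rs_uniq rs0] := symmetric_prod_eq0 (adjmx_tr R G).
have := perm_hom_eigen_of_prod comA irrT small rs_uniq (symmetry_repr_hom vT).
rewrite rs0 mulmx0 => /(_ erefl)/eqP.
by rewrite mulmxBr mul_mx_scalar subr_eq0 => /eqP.
Qed.

Lemma balanced_irreducible_equiv (R : realType) (n d : nat) (G : sgraph n)
    (Sigma : {group {perm 'I_n}}) (v w : 'M[R]_(n, d)) (theta : R) :
  full_dimensional v -> full_dimensional w ->
  irreducible_sym_realization Sigma v -> sym_realization Sigma w ->
  balanced G v theta -> balanced G w theta ->
  (gmult G theta < 2 * d)%N -> realization_equiv v w.
Proof.
move=> /eqP vfull /eqP wfull [T [vT irrT]] [T' wT'].
move=> /balancedP/eigenspaceP vsub /balancedP/eigenspaceP wsub mult_lt.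
have sub : (v^T <= w^T)%MS.
  apply: (perm_hom_sub irrT (symmetry_repr_hom vT) (symmetry_repr_hom wT')).
  (* Were the intersection zero, the sum would have dimension [2 * d] inside the eigenspace of
     [theta]. *)
  apply/eqP => cap0; have := mxrank_sum_cap v^T w^T.
  rewrite cap0 mxrank0 addn0 !mxrank_tr vfull wfull addnn -mul2n => rk.
  have /mxrankS : (v^T + w^T <= eigenspace (adjmx R G) theta)%MS.
    by rewrite addsmx_sub vsub wsub.
  by rewrite rk leqNgt mult_lt.
(* Both spaces have dimension [d], so one inclusion is enough. *)
rewrite /realization_equiv sub -(mxrank_leqif_sup sub).2 !mxrank_tr.
by rewrite vfull wfull /=.
Qed.

Theorem theorem2p22 (R : realType) (n d : nat) (G : sgraph n)
  (Sigma : {group {perm 'I_n}}) (hSigma : Sigma \subset graph_aut G)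
  (v : 'M[R]_(n, d))
  (hfull : full_dimensional v)
  (hirr : irreducible_sym_realization Sigma v)
  (theta : R) (mu1 mu2 : nat)
  (hmu1 : unique_largest_mult G theta mu1)
  (hmu2 : second_largest_mult G theta mu2) :
  ((mu2 < d)%N -> balanced G v theta) /\
  ((mu2 < d)%N -> (mu1 < 2 * d)%N -> rigid Sigma v).
Proof.
have bal (w : 'M[R]_(n, d)) : (mu2 < d)%N ->
    irreducible_sym_realization Sigma w -> balanced G w theta.
  move=> mu2d irrw; apply: (irreducible_balanced hSigma irrw) => r r_neq.
  exact: leq_ltn_trans (gmult_le_second hmu2 r_neq) mu2d.
split=> [mu2d | mu2d mu1d [gamma [gammac gammaS gamma0]]]; first exact: bal.
have irr1 : irreducible_sym_realization Sigma (gamma 1).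
  by apply: irreducible_sym_realization_curve gammac gammaS _; rewrite gamma0.
have [full1 _] : realization_space Sigma (gamma 1).
  by apply: gammaS; rewrite ler01 lexx.
have [_ mult1 _] := hmu1.
apply; apply: (balanced_irreducible_equiv full1 hfull irr1 _
  (bal _ mu2d irr1) (bal _ mu2d hirr)).
  by have [T [vT _]] := hirr; exists T.
by rewrite mult1.
Qed.
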